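(* Let $\varepsilon\in[0,1]$ and $\delta\in[0,1/3]$. Let $\mathcal A$ be an $(\varepsilon,\delta)$-DP (with respect to event-level neighboring streams) continual mechanism in the exact setting (multiplicative error $\eta=1$) that runs on incremental edge streams of length $T$ over graphs with $n$ vertices and has additive error $\alpha$. Then: (i) if $\mathcal A$ maintains the size of a maximum matching, $\alpha=\Omega(\min\{T^{1/4},n^{1/4}\})$; (ii) if $\mathcal A$ maintains the degree histogram (error measured in $\ell_\infty$), $\alpha=\Omega(\min\{T^{1/4},n^{1/2}\})$; (iii) if $\mathcal A$ maintains the core number of a fixed designated vertex $v$, $\alpha=\Omega(\min\{T^{1/8},n^{1/4}\})$. The constants hidden in $\Omega$ are absolute.
   Context: Streams and continual release: Fix a universe $\mathcal U=[h]\cup\{\bot\}$ where $\bot$ is an empty element. A fully dynamic stream of length $T$ is a sequence $u=(u^1,\dots,u^T)$ with $u^t\in\{+,-\}\times\mathcal U$; it is incremental if every $u^t\in\{+\}\times\mathcal U$. The frequency vector at time $t$ is $f^t\in\mathbb Z^h$ with $f^t_i=\sum_{s\le t,\ u^s\in\{+,-\}\times\{i\}}\mathrm{sgn}(u^s)$, where $\mathrm{sgn}$ is $+1$ for an insertion and $-1$ for a deletion (updates of $\bot$ change nothing). A continual mechanism receives $u^1,\dots,u^T$ one at a time and after receiving $u^t$ outputs a value depending only on $u^1,\dots,u^t$ and its randomness; its output is the sequence of all $T$ outputs. Two streams are event-level neighboring if they differ in at most one time step. A randomized mechanism $\mathcal A$ is $(\varepsilon,\delta)$-DP if for all neighboring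 inputs $u,v$ and all sets $S$ of outputs, $\Pr[\mathcal A(u)\in S]\le e^{\varepsilon}\Pr[\mathcal A(v)\in S]+\delta$. A continual mechanism for a real- or vector-valued quantity $g$ has multiplicative error $\eta\ge 1$ and additive error $\alpha$ if with probability at least $2/3$, simultaneously at all time steps $t$, its output $a^t$ satisfies $\eta^{-1}g^t-\alpha\le a^t\le \eta g^t+\alpha$ (coordinatewise for vector-valued $g$); the exact setting means $\eta=1$. Graph streams: $\mathcal U\setminus\{\bot\}$ is the set of possible edges on a fixed vertex set of $n$ vertices; the graph $G^t$ at time $t$ has edge set $\{e: f^t_e>0\}$. Problems: maximum matching = maximum number of pairwise vertex-disjoint edges; degree histogram $=(d_1,\dots,d_{n-1})$ with $d_i$ the number of vertices of degree $i$; core number of $v$ = the largest $k$ such that $v$ belongs to a subgraph of $G$ of minimum degree at least $k$. *)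

(* Defs.v *)
From HB Require Import structures.
From mathcomp Require Import all_boot all_order all_algebra.
From mathcomp Require Import all_classical all_reals all_analysis.
Set Implicit Arguments. Unset Strict Implicit. Unset Printing Implicit Defensive.
Import Order.TTheory GRing.Theory Num.Theory.
Local Open Scope classical_set_scope.
Local Open Scope ring_scope.

Definition edge (n : nat) := {e : {set 'I_n} | #|e| == 2}.

(* An incremental edge stream of length T: at (0-based) time t the update is
   (+, Some e) (insertion of edge e) or (+, None) (insertion of the empty
   element \bot).  Since every update is an insertion, the sign is implicit. *)
Definition stream (n T : nat) := 'I_T -> option (edge n).

Definition freq n T (u : stream n T) (t : 'I_T) (e : edge n) : nat :=
  #|[set s : 'I_T | (s <= t)%N && (u s == Some e)]|.

Definition present n T (u : stream n T) (t : 'I_T) (e : edge n) : bool :=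
  (0 < freq u t e)%N.

Definition neighboring n T (u v : stream n T) : Prop :=
  (#|[set t : 'I_T | u t != v t]| <= 1)%N.

Definition is_matching n (G : pred (edge n)) (M : {set edge n}) : bool :=
  [forall e in M, G e] &&
  [forall e in M, forall e' in M, (e != e') ==> [disjoint val e & val e']].

Definition max_matching n (G : pred (edge n)) : nat :=
  \max_(M : {set edge n} | is_matching G M) #|M|.

Definition degree n (G : pred (edge n)) (x : 'I_n) : nat :=
  #|[set e : edge n | G e && (x \in val e)]|.

(* degree histogram (d_1, ..., d_{n-1}); coordinate j stands for d_{j+1} *)
Definition degree_histogram n (G : pred (edge n)) (j : 'I_n.-1) : nat :=
  #|[set x : 'I_n | degree G x == j.+1]|.

Definition in_k_subgraph n (G : pred (edge n)) (v : 'I_n) (k : nat) : bool :=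
  [exists S : {set 'I_n}, exists F : {set edge n},
     [&& v \in S,
         [forall e in F, G e && (val e \subset S)] &
         [forall w in S, (k <= #|[set e in F | w \in val e]|)%N]]].

(* core number: largest such k (any such k is < n, and k = 0 always works) *)
Definition core_number n (G : pred (edge n)) (v : 'I_n) : nat :=
  \max_(k < n | in_k_subgraph G v k) k.

Section Mechanisms.
Context {R : realType} {d : measure_display} {Omega : measurableType d}
        {n T : nat} {Out : Type}.

Definition online (M : Omega -> stream n T -> 'I_T -> Out) : Prop :=
  forall (w : Omega) (u v : stream n T) (t : 'I_T),
    (forall s : 'I_T, (s <= t)%N -> u s = v s) -> M w u t = M w v t.

Definition dp (P : probability Omega R) (M : Omega -> stream n T -> 'I_T -> Out)
    (eps delta : R) : Prop :=
  forall u v : stream n T, neighboring u v ->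
  forall S : set ('I_T -> Out),
    measurable ((fun w => M w u) @^-1` S) ->
    measurable ((fun w => M w v) @^-1` S) ->
    (P ((fun w => M w u) @^-1` S)
       <= (expR eps)%:E * P ((fun w => M w v) @^-1` S) + delta%:E)%E.

End Mechanisms.

Section Accuracy.
Context {R : realType} {d : measure_display} {Omega : measurableType d}
        {n T : nat}.

Definition measurable_mech (M : Omega -> stream n T -> 'I_T -> R) : Prop :=
  forall u t, measurable_fun setT (fun w => M w u t).

Definition measurable_mech_vec k (M : Omega -> stream n T -> 'I_T -> 'I_k -> R)
  : Prop := forall u t j, measurable_fun setT (fun w => M w u t j).

Definition exact_accurate (P : probability Omega R)
    (M : Omega -> stream n T -> 'I_T -> R) (g : stream n T -> 'I_T -> R)
    (alpha : R) : Prop :=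
  forall u : stream n T,
    (P [set w | forall t : 'I_T, (g u t - alpha <= M w u t <= g u t + alpha)%R]
       >= (2 / 3 : R)%:E)%E.

Definition exact_accurate_vec k (P : probability Omega R)
    (M : Omega -> stream n T -> 'I_T -> 'I_k -> R)
    (g : stream n T -> 'I_T -> 'I_k -> R) (alpha : R) : Prop :=
  forall u : stream n T,
    (P [set w | forall (t : 'I_T) (j : 'I_k),
                  (g u t j - alpha <= M w u t j <= g u t j + alpha)%R]
       >= (2 / 3 : R)%:E)%E.

End Accuracy.

(* Main.v *)
(* A database x is a set of bits, indexed by a set of k = 2^l elements.  It is
   encoded by a stream in which each bit is one update, so that flipping a bit
   gives a neighboring stream; the other updates are independent of x and turn
   the monitored quantity, at k successive times, into c +- #|x :&: Q| for the
   queries Q that are the rows of a Hadamard matrix.  By Parseval's identity, two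
   databases whose answers to all these queries differ by at most 2 alpha are at
   Hamming distance O(alpha^2), so an accurate output determines x up to
   O(alpha^2) bits.  Differential privacy does not allow this unless
   k = O(alpha^2).  The encodings need n, T = O(k^2) for matchings, n = O(k) and
   T = O(k^2) for degree histograms, n = O(k^2) and T = O(k^4) for cores. *)
Require Import Defs.
From HB Require Import structures.
From mathcomp Require Import all_boot all_order all_algebra.
From mathcomp Require Import all_classical all_reals all_analysis.
From mathcomp Require Import perm zify ring lra.
Set Implicit Arguments. Unset Strict Implicit. Unset Printing Implicit Defensive.
Import Order.TTheory GRing.Theory Num.Theory.
Local Open Scope ring_scope.

(** * Hadamard queries *)

Definition hdist (I : finType) (x y : {set I}) : nat :=
  #|[set i | (i \in x) != (i \in y)]|.

(** The entry [(-1) ^+ #|A :&: B|] of the Sylvester-Hadamard matrix, written as a product over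
    coordinates so that a sum over [A] factors. *)
Definition walsh (R : comNzRingType) l (A B : {set 'I_l}) : R :=
  \prod_i (if i \in A then (-1) ^+ (i \in B) else 1).

(** The sum over [A] factors into two-term sums, one per coordinate; a coordinate where [B] and [C]
    differ contributes [-1 + 1]. *)
Lemma walsh_orth (R : comNzRingType) l (B C : {set 'I_l}) :
  \sum_A walsh R A B * walsh R A C = (B == C)%:R * 2 ^+ l.
Proof.
have -> : \sum_A walsh R A B * walsh R A C =
    \prod_i ((-1) ^+ (i \in B) * (-1) ^+ (i \in C) + 1).
  rewrite bigA_distr; apply: eq_bigr => A _; rewrite -big_split /=.
  by apply: eq_bigr => i _; case: ifP; rewrite ?mulr1.
have [->|/eqP neBC] := eqVneq B C.
  rewrite mul1r (eq_bigr (fun=> 2)) => [|i _]; last by rewrite -expr2 sqrr_sign.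
  by rewrite prodr_const card_ord.
have [i neq_i] : exists i, (i \in B) != (i \in C).
  by apply/existsP; apply: contra_notT neBC => /existsPn e; apply/setP => i;
    apply/eqP; rewrite -[_ == _]negbK e.
rewrite mul0r (bigD1 i) //= [X in X * _](_ : _ = 0) ?mul0r //.
by move: neq_i; case: (i \in B); case: (i \in C) => //= _;
  rewrite ?expr1 ?expr0; ring.
Qed.

Lemma walsh_parseval (R : comNzRingType) l (z : {set 'I_l} -> R) :
  \sum_A (\sum_B walsh R A B * z B) ^+ 2 = 2 ^+ l * \sum_B z B ^+ 2.
Proof.
under eq_bigr => A _ do rewrite expr2 big_distrlr /=.
rewrite exchange_big mulr_sumr /=; apply: eq_bigr => B _.
rewrite exchange_big (bigD1 B) //= [X in _ + X]big1 => [|C /negPf neCB].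
  rewrite addr0 (_ : \sum_A _ = (\sum_A walsh R A B * walsh R A B) * z B ^+ 2).
    by rewrite walsh_orth eqxx mul1r.
  by rewrite mulr_suml; apply: eq_bigr => A _; ring.
rewrite (_ : \sum_A _ = (\sum_A walsh R A B * walsh R A C) * (z B * z C)).
  by rewrite walsh_orth eq_sym neCB !mul0r.
by rewrite mulr_suml; apply: eq_bigr => A _; ring.
Qed.

(** The sign is tested in [int], so that the query does not depend on the ring of the analysis. *)
Definition walsh_query l (A : {set 'I_l}) : {set {set 'I_l}} :=
  [set B | walsh int A B == 1].

Lemma walsh_sign (R : comNzRingType) l (A B : {set 'I_l}) :
  walsh R A B = if B \in walsh_query A then 1 else -1.
Proof.
pose b := \big[addb/false]_i ((i \in A) && (i \in B)).
have wE (S : comNzRingType) : walsh S A B = (-1) ^+ b.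
  rewrite /walsh /b; elim/big_ind2: _ => // [u1 u2 v1 v2 -> ->|i _].
    by rewrite signr_addb.
  by case: ifP.
by rewrite inE !wE; case: (b).
Qed.

(** A Walsh coefficient of the difference [z] of the indicators is twice the sum of [z] over a query
    minus its total sum, hence at most [3 * a] in absolute value. By Parseval the mean squared
    coefficient is the sum of [z B ^+ 2], which is the Hamming distance. *)
Lemma hadamard_reconstruction (R : realFieldType) l (x y : {set {set 'I_l}})
    (a : R) :
  (forall A, `|#|x :&: walsh_query A|%:R - #|y :&: walsh_query A|%:R| <= a) ->
  (hdist x y)%:R <= 9 * a ^+ 2.
Proof.
move=> close; pose z B : R := (B \in x)%:R - (B \in y)%:R.
have queryE A : \sum_(B in walsh_query A) z B =
    #|x :&: walsh_query A|%:R - #|y :&: walsh_query A|%:R.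
  rewrite /z sumrB; congr (_ - _); rewrite -sum1_card natr_sum big_mkcond;
    rewrite [RHS]big_mkcond; apply: eq_bigr => B _; rewrite finset.in_setI;
    by do 2 case: (_ \in _).
(* The row of the empty set is constantly 1, so its query counts the whole database. *)
have query0 (B : {set 'I_l}) : (B \in walsh_query finset.set0) = true.
  by rewrite inE; apply/eqP; rewrite /walsh big1 // => i _; rewrite inE.
have bound A : (\sum_B walsh R A B * z B) ^+ 2 <= 9 * a ^+ 2.
  have -> : \sum_B walsh R A B * z B =
      2 * \sum_(B in walsh_query A) z B - \sum_(B in walsh_query finset.set0) z B.
    rewrite (eq_bigl _ _ query0) (big_mkcond (fun B => B \in _)) mulr_sumr -sumrB.
    by apply: eq_bigr => B _; rewrite walsh_sign; case: ifP => _; ring.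
  have := close A; have := close finset.set0; rewrite -!queryE.
  rewrite !ler_norml; set u := \sum_(_ in _) _; set v := \sum_(_ in _) _.
  by move=> /andP[? ?] /andP[? ?]; nra.
have distE : (hdist x y)%:R = \sum_B z B ^+ 2.
  rewrite /hdist -sum1_card natr_sum big_mkcond; apply: eq_bigr => B _.
  by rewrite inE /z; do 2 case: (_ \in _); rewrite /= ?subrr ?subr0 ?sub0r;
    rewrite ?sqrrN ?expr1n ?expr0n.
have pos : 0 < 2 ^+ l :> R by rewrite exprn_gt0.
rewrite distE -(ler_pM2l pos) -walsh_parseval.
apply: le_trans (ler_sum _ (fun A _ => bound A)) _.
by rewrite sumr_const -finset.cardsT -powersetT card_powerset finset.cardsT
  card_ord -natrX (mulr_natl (9 * _)).
Qed.

(** * Differential privacy prevents reconstruction *)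

Definition flip (I : finType) (x : {set I}) (i : I) : {set I} :=
  [set j | (j \in x) (+) (j == i)].

Lemma flipK (I : finType) (i : I) : involutive (fun x => flip x i).
Proof. by move=> x; apply/setP => j; rewrite !inE -addbA addbb addbF. Qed.

Lemma hdist_flip (I : finType) (x : {set I}) i : hdist x (flip x i) = 1%N.
Proof.
rewrite /hdist -(finset.cards1 i); apply: eq_card => j; rewrite !inE.
by case: (j \in x); case: (j == i).
Qed.

Lemma leq_hdist_flip (I : finType) (x y : {set I}) i :
  (hdist y x <= (hdist y (flip x i)).+1)%N.
Proof.
rewrite /hdist -add1n -(finset.cards1 i); apply: leq_trans (leq_card_setU _ _).
apply: subset_leq_card; apply/fintype.subsetP => j; rewrite !inE.
by case: (j \in x); case: (j == i); case: (j \in y).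
Qed.

(* Flipping a random bit i of x: on outcomes good for x the decoded database
   mostly agrees with x at i, whereas the same outcome under the flipped
   database is a decoding error at i, and few coordinates are erroneous. *)
Lemma finite_dp_bound (R : realType) (I Y : finType)
    (good : {set I} -> pred Y) (mu : {set I} -> Y -> R) (E delta D : R) :
  0 <= E <= 4 -> delta <= 3^-1 -> 0 <= D ->
  (forall x y, 0 <= mu x y) -> (forall x, \sum_y mu x y <= 1) ->
  (forall x x', (hdist x x' <= 1)%N -> forall Q : pred Y,
     \sum_(y | Q y) mu x y <= E * \sum_(y | Q y) mu x' y + delta) ->
  (forall x, 2 / 3 <= \sum_(y | good x y) mu x y) ->
  (forall y x x', good x y -> good x' y -> (hdist x x')%:R <= D) ->
  #|I|%:R <= 15 * D + 12.
Proof.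
move=> /andP[E0 E4] delta3 D0 mu0 mu1 dpmu acc cons.
have [ltD|] := ltP D #|I|%:R; last by move=> ?; lra.
(* Decode [y] to any database it is good for; the default occurs only if there is none. *)
pose xh y := odflt finset.set0 [pick x | good x y].
have xhP x y : good x y -> good (xh y) y.
  by rewrite /xh; case: pickP => [//|/(_ x)->].
pose S x i y := good x y && ((i \in xh y) == (i \in x)).
(* A good outcome is decoded with at most [D] wrong bits, and good outcomes have mass at least
   2/3. *)
have hit x : (#|I|%:R - D) * (2 / 3) <= \sum_i \sum_(y | S x i y) mu x y.
  apply: (@le_trans _ _ (\sum_(y | good x y) (#|I|%:R - D) * mu x y)).
    by rewrite -mulr_sumr ler_wpM2l // subr_ge0 ltW.
  under [leRHS]eq_bigr => i _ do rewrite big_mkcondr.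
  rewrite exchange_big /=; apply: ler_sum => y gxy.
  rewrite -big_mkcond sumr_const -[leRHS]mulr_natl ler_wpM2r //.
  rewrite lerBlDr; have /= := cons y _ _ (xhP _ _ gxy) gxy.
  rewrite -(lerD2l #|[pred i | (i \in xh y) == (i \in x)]|%:R).
  apply: le_trans; rewrite -natrD ler_nat.
  rewrite -(cardC [pred i | (i \in xh y) == (i \in x)]) leq_add2l.
  by apply: subset_leq_card; apply/fintype.subsetP => i; rewrite !inE.
(* If [y] counts for some [i], then [xh y] is within [D] of [flip x i], hence within [D + 1] of [x];
   and every [i] that counts is a bit where [xh y] and [x] differ. *)
have miss x : \sum_i \sum_(y | S (flip x i) i y) mu x y <= D + 1.
  under eq_bigr => i _ do rewrite big_mkcond.
  rewrite exchange_big /=.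
  apply: (@le_trans _ _ (\sum_y (D + 1) * mu x y)); last first.
    by rewrite -mulr_sumr; apply: ler_piMr (mu1 x); lra.
  apply: ler_sum => y _.
  rewrite -big_mkcond sumr_const -[leLHS]mulr_natl ler_wpM2r //.
  case: (pickP [pred i | S (flip x i) i y]) => [i|S0]; last first.
    by rewrite eq_card0 => [|i]; [rewrite mulr0n; lra|exact: S0].
  rewrite /= => /andP[gy _]; have := cons y _ _ (xhP _ _ gy) gy.
  rewrite -(lerD2r 1); apply: le_trans; rewrite -(natrD _ _ 1) ler_nat addn1.
  apply: leq_trans (leq_hdist_flip x (xh y) i); apply: subset_leq_card.
  apply/fintype.subsetP => j; rewrite !inE => /andP[_]; rewrite !inE eqxx.
  by case: (j \in x); case: (j \in xh y).
have swap : \sum_x \sum_i \sum_(y | S x i y) mu (flip x i) y =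
    \sum_x \sum_i \sum_(y | S (flip x i) i y) mu x y.
  rewrite exchange_big [RHS]exchange_big; apply: eq_bigr => i _ /=.
  rewrite (reindex_inj (inv_inj (flipK i))) /=.
  by apply: eq_bigr => x _; rewrite flipK.
have N0 : 0 < #|{set I}|%:R :> R by rewrite ltr0n; apply/card_gt0P; exists finset.set0.
(* Privacy compares the hits of [x] at bit [i] with the same event under [flip x i]; summed over all
   [x], these are misses by [swap]. *)
have key : #|{set I}|%:R * ((#|I|%:R - D) * (2 / 3)) <=
    #|{set I}|%:R * (E * (D + 1) + #|I|%:R * delta).
  apply: (@le_trans _ _ (\sum_x \sum_i \sum_(y | S x i y) mu x y)).
    by rewrite mulr_natl -sumr_const; apply: ler_sum => x _.
  apply: (@le_trans _ _ (\sum_x \sum_i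
      (E * (\sum_(y | S x i y) mu (flip x i) y) + delta))).
    by apply: ler_sum => x _; apply: ler_sum => i _; apply: dpmu;
      rewrite hdist_flip.
  under eq_bigr => x _ do
    rewrite big_split /= sumr_const -mulr_sumr -[delta *+ _]mulr_natl.
  rewrite big_split /= sumr_const -mulr_sumr swap -[_ *+ _]mulr_natl mulrDr.
  rewrite lerD2r mulrCA ler_wpM2l // mulr_natl -sumr_const.
  exact: ler_sum.
rewrite ler_pM2l // in key.
have I0 : 0 <= #|I|%:R :> R by [].
have : E * (D + 1) <= 4 * (D + 1) by apply: ler_wpM2r => //; lra.
have : #|I|%:R * delta <= #|I|%:R * 3^-1 by apply: ler_wpM2l.
lra.
Qed.

Lemma expR1_le4 (R : realType) : expR 1 <= 4 :> R.
Proof.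
have := expR_ge1Dx (- 2^-1 : R); rewrite expRN => h.
have e0 := expR_gt0 (2^-1 : R).
have e2 : expR 2^-1 <= 2 :> R.
  rewrite -lef_pV2 ?posrE //; lra.
have -> : (1 : R) = 2^-1 + 2^-1 by lra.
by rewrite expRD; nra.
Qed.

Local Open Scope classical_set_scope.

Lemma measurable_finite_pattern d (Omega : measurableType d) (J : finType)
    (B : J -> set Omega) (Q : pred {set J}) :
  (forall j, measurable (B j)) ->
  measurable [set w | Q [set j | `[< B j w >]]%SET].
Proof.
move=> mB.
have -> : [set w | Q [set j | `[< B j w >]]%SET] =
    \bigcup_(p in [set p | Q p])
      \bigcap_(j in setT) (if j \in p then B j else ~` B j).
  apply/seteqP; split => [w /= Qw|w [p /= Qp] wp].
    exists [set j | `[< B j w >]]%SET => //= j _; rewrite inE.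
    by case: asboolP.
  rewrite (_ : [set j | _]%SET = p) //; apply/setP => j; rewrite inE.
  by move: (wp j I); case: ifP => _; case: asboolP.
apply: fin_bigcup_measurable => // p _; apply: fin_bigcap_measurable => // j _.
by case: ifP => _ //; apply: measurableC.
Qed.

(** Of an output, only the set of databases for which it is acceptable matters. This pattern takes
    finitely many values and its events are measurable, which reduces the claim to the finite
    case. *)
Lemma dp_reconstruction_bound (R : realType) d (Omega : measurableType d)
    (P : probability Omega R) n T Out (M : Omega -> stream n T -> 'I_T -> Out)
    (eps delta D : R) (I : finType) (enc : {set I} -> stream n T)
    (acc : {set I} -> set ('I_T -> Out)) :
  0 <= eps <= 1 -> delta <= 3^-1 -> 0 <= D -> dp P M eps delta ->
  (forall x y, (hdist x y <= 1)%N -> neighboring (enc x) (enc y)) ->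
  (forall x y, measurable ((fun w => M w (enc x)) @^-1` acc y)) ->
  (forall x, ((2 / 3 : R)%:E <= P ((fun w => M w (enc x)) @^-1` acc x))%E) ->
  (forall o x y, acc x o -> acc y o -> (hdist x y)%:R <= D) ->
  #|I|%:R <= 15 * D + 12.
Proof.
move=> /andP[eps0 eps1] delta3 D0 dpM enc1 mM accM cons.
pose pat o := [set y | `[< acc y o >]]%SET.
pose mu x p := fine (P [set w | pat (M w (enc x)) == p]).
have muE x (Q : pred {set {set I}}) :
    ((\sum_(p | Q p) mu x p)%:E = P [set w | Q (pat (M w (enc x)))])%E.
  have mF p : measurable [set w | pat (M w (enc x)) == p].
    exact: (measurable_finite_pattern (pred1 p) (mM x)).
  have -> : [set w | Q (pat (M w (enc x)))] =
      \bigcup_(p in [set` enum Q]) [set w | pat (M w (enc x)) == p].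
    apply/seteqP; split => [w /= Qw|w [p /=]].
      by exists (pat (M w (enc x))); rewrite /= ?mem_enum.
    by rewrite mem_enum => Qp /eqP ->.
  rewrite measure_fin_bigcup //; first last.
  - by move=> p q _ _ [w [/= /eqP -> /eqP]].
  rewrite -fsbig_seq ?enum_uniq // big_enum -sumEFin.
  by apply: eq_bigr => p _; rewrite /mu fineK // fin_num_measure.
(* Patterns that no output realizes must be consistent too, so pairwise closeness is made part of
   being good. *)
pose good x (p : {set {set I}}) :=
  (x \in p) && [forall a in p, forall b in p, (hdist a b)%:R <= D].
apply: (@finite_dp_bound R I _ good mu (expR eps) delta D) => //.
- by rewrite expR_ge0 (le_trans _ (expR1_le4 R)) // ler_expR.
- by move=> x p; apply: fine_ge0.
- by move=> x; rewrite -lee_fin (muE x xpredT); apply: probability_le1;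
  exact: (measurable_finite_pattern xpredT (mM x)).
- move=> x x' /enc1 nb Q; rewrite -lee_fin EFinD EFinM !muE.
  have mQ y : measurable ((fun w => M w (enc y)) @^-1` [set o | Q (pat o)]).
    exact: (measurable_finite_pattern Q (mM y)).
  exact: dpM nb _ (mQ x) (mQ x').
- move=> x; rewrite -lee_fin muE; apply: le_trans (accM x) _.
  apply: le_measure; rewrite ?inE //.
    exact: (measurable_finite_pattern (good x) (mM x)).
  move=> w /= aw; rewrite /good inE; apply/andP; split; first exact/asboolP.
  apply/forall_inP => a; rewrite inE => /asboolP aa.
  by apply/forall_inP => b; rewrite inE => /asboolP; apply: cons aa.
- move=> p x x' /andP[xp /forall_inP h] /andP[x'p _].
  by have /forall_inP := h x xp; apply.
Qed.
Local Close Scope classical_set_scope.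

(** * Streams encoding a database *)

(** Listing the new elements of each set after those of the previous one makes every [E j] a prefix,
    so inserting the list in order passes through the whole chain. *)
Lemma chain_enumeration (Y : finType) (E : nat -> {set Y}) J :
  (forall j, E j \subset E j.+1) ->
  exists2 s : seq Y, size s = #|E J| &
    forall j, (j <= J)%N -> take #|E j| s =i E j.
Proof.
move=> chainE; elim: J => [|J [s sizes sE]].
  exists (enum (E 0%N)) => [|j]; first by rewrite cardE.
  by rewrite leqn0 => /eqP -> e; rewrite cardE take_size mem_enum.
exists (s ++ enum (E J.+1 :\: E J)).
  by rewrite size_cat sizes -cardE finset.cardsD (finset.setIidPr _) //
    subnKC // subset_leq_card.
have sub i j : (i <= j)%N -> E i \subset E j.
  elim: j => [|j IH]; first by rewrite leqn0 => /eqP ->.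
  by rewrite leq_eqVlt ltnS => /orP[/eqP -> //|/IH/fintype.subset_trans]; apply.
move=> j; rewrite leq_eqVlt => /orP[/eqP -> e|]; last first.
  by rewrite ltnS => le_jJ e; rewrite takel_cat ?sE // sizes subset_leq_card ?sub.
rewrite take_oversize; last first.
  by rewrite size_cat sizes -cardE finset.cardsD (finset.setIidPr _) //
    subnKC // subset_leq_card.
have /(_ e) := sE _ (leqnn J); rewrite -sizes take_size mem_cat => ->.
rewrite mem_enum !inE; have /fintype.subsetP/(_ e) := chainE J.
by case: (e \in E J) => // ->.
Qed.

Lemma presentP n T (u : stream n T) (t : 'I_T) e :
  reflect (exists2 s : 'I_T, (s <= t)%N & u s = Some e) (present u t e).
Proof.
apply: (iffP card_gt0P) => [[s]|[s le_st us]].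
  by rewrite inE => /andP[le_st /eqP]; exists s.
by exists s; rewrite inE /= le_st us eqxx.
Qed.

(* Each bit of the database is one update among the first #|I|; the remaining
   updates do not depend on the database. *)
Lemma stream_encoding n T J (I : finType) (b : I -> edge n)
    (E : nat -> {set edge n}) :
  (0 < #|I|)%N -> (forall j, E j \subset E j.+1) -> (#|I| + #|E J| <= T)%N ->
  exists2 enc : {set I} -> stream n T,
    forall x y, (hdist x y <= 1)%N -> neighboring (enc x) (enc y) &
    forall j, (j <= J)%N -> exists t : 'I_T, forall x,
      present (enc x) t =1 fun e => (e \in E j) || [exists i in x, b i == e].
Proof.
move=> I0 chainE leT; have [s sizes sE] := chain_enumeration J chainE.
have leIT : (#|I| <= T)%N by apply: leq_trans leT; apply: leq_addr.
pose bit (x : {set I}) i := if i \in x then Some (b i) else None.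
(* Bits first, then the list [s]; the default [None] fills the remaining time with empty updates. *)
pose enc (x : {set I}) (t : 'I_T) :=
  nth None (map (bit x) (enum I) ++ map Some s) t.
have enc_bit x (t : 'I_T) (lt_t : (t < #|I|)%N) :
    enc x t = bit x (enum_val (Ordinal lt_t)).
  have [i0 _] := card_gt0P I0.
  rewrite /enc nth_cat size_map -cardE lt_t (nth_map i0) -?cardE //.
  by rewrite (enum_val_nth i0).
have enc_fill x (t : 'I_T) :
    (#|I| <= t)%N -> enc x t = nth None (map Some s) (t - #|I|).
  by rewrite /enc nth_cat size_map -cardE ltnNge => ->.
exists enc => [x y dxy|j le_jJ].
  apply: leq_trans dxy.
  rewrite (leq_trans _ (leq_imset_card (fun i => widen_ord leIT (enum_rank i)) _)) //.
  apply: subset_leq_card; apply/fintype.subsetP => t; rewrite inE /=.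
  have [le_t|lt_t] := leqP #|I| t; first by rewrite !enc_fill // eqxx.
  rewrite !enc_bit => neq; apply/imsetP; exists (enum_val (Ordinal lt_t)).
    rewrite inE; apply: contra neq => /eqP exy.
    by rewrite /bit exy eqxx.
  by apply: val_inj; rewrite /= enum_valK.
have leEs : (#|E j| <= size s)%N.
  by have := uniq_leq_size (enum_uniq (E j)) => /(_ (take #|E j| s));
    rewrite -cardE size_take_min leq_min => /(_ _)/andP[|//] e;
    rewrite mem_enum sE.
(* The time at which all bits and exactly [E j] have been processed; times start at 0, hence the
   predecessor. *)
have ltT : ((#|I| + #|E j|).-1 < T)%N.
  rewrite prednK ?addn_gt0 ?I0 //; apply: leq_trans leT.
  by rewrite leq_add2l -sizes.
exists (Ordinal ltT) => x e; apply/presentP/orP => [[r /= le_r]|].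
  have [le_Ir|lt_r] := leqP #|I| r; last first.
    rewrite enc_bit /bit; case: ifP => // xi [<-]; right; apply/existsP.
    by exists (enum_val (Ordinal lt_r)); rewrite xi /=.
  rewrite enc_fill // => re; left; rewrite -sE // -(mem_map Some_inj) map_take.
  have lt_r : (r - #|I| < #|E j|)%N.
    by rewrite ltn_subLR // -(prednK (ltn_addr _ I0)) ltnS.
  apply/(nthP None); exists (r - #|I|)%N; last by rewrite nth_take.
  by rewrite size_takel // size_map.
case=> [|/existsP[i /andP[xi /eqP <-]]].
  rewrite -sE // -(mem_map Some_inj) map_take => /(nthP None)[r].
  rewrite size_takel ?size_map // => lt_r; rewrite nth_take // => re.
  have lt_rT : (#|I| + r < T)%N.
    by apply: leq_trans ltT; rewrite ltnS -ltnS prednK ?ltn_add2l // addn_gt0 I0.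
  exists (Ordinal lt_rT); first by rewrite /= -ltnS prednK ?ltn_add2l // addn_gt0 I0.
  by rewrite enc_fill /= ?leq_addr // addKn.
have lt_i := ltn_ord (enum_rank i).
exists (widen_ord leIT (enum_rank i)); first by
  rewrite /= -ltnS prednK ?addn_gt0 ?I0 // ltn_addr.
by rewrite enc_bit /bit (_ : Ordinal _ = enum_rank i) ?enum_rankK ?xi //; apply: val_inj.
Qed.

(** * Graphs presented by a relation on vertex labels *)

Lemma mem_mkset (X : Type) (P : pred X) x : (x \in [set z | P z]%classic) = P x.
Proof. by apply/idP/idP; rewrite inE. Qed.

Lemma edge_between n (x y : 'I_n) :
  x != y -> exists e : edge n, val e = [set x; y].
Proof.
by move=> neq; have e2 : #|[set x; y]| == 2 by [rewrite cards2 neq];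
  exists (exist (fun e : {set 'I_n} => #|e| == 2) _ e2).
Qed.

(** [f] places the labels among the vertices, and [phi] acts as an orientation: adjacency is
    [phi a b || phi b a], so an edge can be listed once. *)
Definition edges_of (V : finType) n (f : V -> 'I_n) (phi : rel V) :
    {set edge n} :=
  [set e | [exists a, exists b, phi a b && (val e == [set f a; f b])]].

Section EdgesOf.
Variables (V : finType) (n : nat) (f : V -> 'I_n).
Implicit Types phi psi : rel V.

Lemma edges_ofP phi (e : edge n) :
  reflect (exists a b, phi a b /\ val e = [set f a; f b]) (e \in edges_of f phi).
Proof.
rewrite inE; apply: (iffP existsP) => [[a /existsP[b /andP[ab /eqP]]]|[a [b [ab ee]]]].
  by exists a, b.
by exists a; apply/existsP; exists b; rewrite ab ee eqxx.
Qed.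

Lemma edges_of_sub phi psi : subrel phi psi -> edges_of f phi \subset edges_of f psi.
Proof.
move=> sub; apply/fintype.subsetP => e /edges_ofP[a [b [ab ee]]].
by apply/edges_ofP; exists a, b; split => //; apply: sub.
Qed.

Lemma card_edges_of phi : (#|edges_of f phi| <= #|[pred p | phi p.1 p.2]|)%N.
Proof.
rewrite -(card_imset _ val_inj).
apply: leq_trans (leq_imset_card (fun p => [set f p.1; f p.2]) _).
apply: subset_leq_card; apply/fintype.subsetP => ? /imsetP[e /edges_ofP[a [b [ab ee]]] ->].
by apply/imsetP; exists (a, b).
Qed.

Hypothesis f_inj : injective f.

(** Sending a neighbour [b] to [[set f a; f b]] is a bijection onto the incident edges;
    irreflexivity excludes the loop [b = a]. *)
Lemma card_incident phi a : irreflexive phi ->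
  #|[set e in edges_of f phi | f a \in val e]| = #|[set b | phi a b || phi b a]|.
Proof.
move=> irr; rewrite -(card_imset _ val_inj).
have inj : {in [set b | phi a b || phi b a] &, injective (fun b => [set f a; f b])}.
  move=> b c; rewrite !inE => ab ac /finset.setP/(_ (f b)).
  rewrite !inE eqxx orbT => /esym/orP[/eqP/f_inj eq_ba|/eqP/f_inj //].
  by move: ab; rewrite eq_ba irr.
rewrite -(card_in_imset inj); congr #|pred_of_set _|; apply/setP => z.
apply/imsetP/imsetP => [[e]|[b]].
  rewrite inE => /andP[/edges_ofP[c [b [cb ee]]]].
  rewrite ee !inE => /orP[/eqP/f_inj|/eqP/f_inj] ->.
    by move=> ->; exists b; rewrite ?inE ?cb.
  by move=> ->; exists c; rewrite ?inE ?cb ?orbT // finset.setUC.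
rewrite inE => ab ->.
have /edge_between[e ee] : f a != f b.
  by apply: contraTneq ab => /f_inj ->; rewrite irr.
exists e; last by rewrite ee.
rewrite inE; apply/andP; split; last by rewrite ee !inE eqxx.
by apply/edges_ofP; case/orP: ab => ab; [exists a, b|exists b, a];
  rewrite ee 1?finset.setUC.
Qed.

Lemma degree_edges_of phi a : irreflexive phi ->
  degree (fun e => e \in edges_of f phi) (f a) = #|[set b | phi a b || phi b a]|.
Proof.
by move=> /card_incident <-; apply: eq_card => e; rewrite mem_mkset [RHS]finset.in_set.
Qed.

Lemma degree_edges_of0 phi (v : 'I_n) : (forall a, f a != v) ->
  degree (fun e => e \in edges_of f phi) v = 0%N.
Proof.
move=> fv; apply: eq_card0 => e; rewrite mem_mkset; apply/negP.
move=> /andP[/edges_ofP[a [b [_ ->]]]]; rewrite !inE.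
by rewrite !(eq_sym v) (negPf (fv a)) (negPf (fv b)).
Qed.

Lemma max_matching_ge phi (A : finType) (B : {set A}) (p q : A -> V) :
  {in B &, injective p} -> {in B &, injective q} ->
  {in B &, forall a b, p a != q b} -> {in B, forall a, phi (p a) (q a)} ->
  (#|B| <= max_matching (fun e => e \in edges_of f phi))%N.
Proof.
move=> p_inj q_inj pq pq_phi.
have [[e0 _]|noE] := pselect (exists e : edge n, True); last first.
  rewrite eq_card0 // => a; apply/negP => aB.
  have /edge_between[e _] : f (p a) != f (q a) by rewrite (inj_eq f_inj) pq.
  by apply: noE; exists e.
have /fin_all_exists[g gE] : forall a, exists e : edge n,
    a \in B -> val e = [set f (p a); f (q a)].
  move=> a; have [aB|_] := boolP (a \in B); last by exists e0.
  have /edge_between[e ee] : f (p a) != f (q a) by rewrite (inj_eq f_inj) pq.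
  by exists e.
have g_meet a b : a \in B -> b \in B -> ~~ [disjoint val (g a) & val (g b)] -> a = b.
  move=> aB bB /pred0Pn[z]; rewrite /= !gE // !inE.
  move=> /andP[/orP[|]/eqP-> /orP[|]]; rewrite (inj_eq f_inj) => /eqP.
  - exact: p_inj.
  - by move=> e; have := pq a b aB bB; rewrite e eqxx.
  - by move=> e; have := pq b a bB aB; rewrite e eqxx.
  - exact: q_inj.
have g_inj : {in B &, injective g}.
  move=> a b aB bB eg; apply: g_meet => //; rewrite eg gE //.
  by apply/pred0Pn; exists (f (p b)); rewrite /= !inE eqxx.
rewrite -(card_in_imset g_inj) /max_matching.
apply: (@leq_bigmax_cond _ _ _ (g @: B)).
apply/andP; split; apply/forall_inP => e /imsetP[a aB ->].
  by apply/edges_ofP; exists (p a), (q a); rewrite gE // pq_phi.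
apply/forall_inP => e' /imsetP[b bB ->]; apply/implyP.
by apply: contraNT => /(g_meet _ _ aB bB) ->.
Qed.

(** Weak duality: each matching edge contains a vertex of the cover [C], and disjoint edges contain
    different ones. *)
Lemma max_matching_le phi (C : {set V}) :
  (forall a b, phi a b -> (a \in C) || (b \in C)) ->
  (max_matching (fun e => e \in edges_of f phi) <= #|C|)%N.
Proof.
move=> cover; apply/bigmax_leqP => M /andP[/forall_inP MG /forall_inP Mdisj].
pose h (e : edge n) := [pick c in C | f c \in val e].
have hM e : e \in M -> exists2 c, h e = Some c & (c \in C) && (f c \in val e).
  move=> /MG/edges_ofP[a [b [ab ee]]]; rewrite /h.
  case: pickP => [c|none]; first by exists c.
  have := none a; have := none b; rewrite /= ee !inE !eqxx orbT !andbT.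
  by move=> bC aC; have := cover _ _ ab; rewrite aC bC.
have h_inj : {in M &, injective h}.
  move=> e e' eM e'M; have [c -> /andP[_ ce]] := hM e eM.
  have [c' -> /andP[_ ce']] := hM e' e'M => -[eq_c].
  have /forall_inP/(_ _ e'M)/implyP disj := Mdisj _ eM.
  apply/eqP; apply: contraT => /disj /pred0P/(_ (f c)) /=.
  by rewrite ce eq_c ce'.
rewrite -(card_in_imset h_inj) -(card_imset C Some_inj).
apply: subset_leq_card; apply/fintype.subsetP => ? /imsetP[e /hM[c -> /andP[cC _]] ->].
by apply/imsetP; exists c.
Qed.

End EdgesOf.

(** The common form of the three encodings: bit [i] is the edge from [p i] to [q i], and [phi j]
    gives the known edges of stage [j]. *)
Lemma graph_encoding n T J (I V : finType) (f : V -> 'I_n) (p q : I -> V)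
    (phi : nat -> rel V) :
  injective f -> (forall i, p i != q i) ->
  (0 < #|I|)%N -> (forall j, subrel (phi j) (phi j.+1)) ->
  (#|I| + #|[pred e | phi J e.1 e.2]| <= T)%N ->
  exists2 enc : {set I} -> stream n T,
    forall x y, (hdist x y <= 1)%N -> neighboring (enc x) (enc y) &
    forall j, (j <= J)%N -> exists t : 'I_T, forall x,
      present (enc x) t = fun e => e \in edges_of f (fun a b =>
        phi j a b || [exists i in x, (a == p i) && (b == q i)]).
Proof.
move=> f_inj pq I0 sub_phi leT.
have /fin_all_exists[b bE] : forall i, exists e : edge n, val e = [set f (p i); f (q i)].
  by move=> i; apply: edge_between; rewrite (inj_eq f_inj).
have chainE j := edges_of_sub f (sub_phi j).
have [|enc enc1 encE] := @stream_encoding n T J I b _ I0 chainE.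
  by apply: leq_trans leT; rewrite leq_add2l card_edges_of.
exists enc => // j /encE[t tE]; exists t => x; apply/funext => e; rewrite tE.
apply/orP/edges_ofP => [[/edges_ofP[a [c [ac ee]]]|/existsP[i /andP[xi /eqP <-]]]|].
- by exists a, c; rewrite ac.
- exists (p i), (q i); split; last exact: bE.
  by apply/orP; right; apply/existsP; exists i; rewrite xi !eqxx.
- move=> [a [c [/orP[ac|/existsP[i /and3P[xi /eqP-> /eqP->]]] ee]]].
    by left; apply/edges_ofP; exists a, c.
  by right; apply/existsP; exists i; rewrite xi; apply/eqP/val_inj; rewrite bE.
Qed.

(** Composing with a transposition moves the image of [a] to [v], as the designated vertex of the
    core problem requires. *)
Lemma injection_to_ord (V : finType) n (a : V) (v : 'I_n) : (#|V| <= n)%N ->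
  exists2 f : V -> 'I_n, injective f & f a = v.
Proof.
move=> leVn; pose g b := widen_ord leVn (enum_rank b).
exists (fun b => tperm (g a) v (g b)); last by rewrite tpermL.
move=> b c /perm_inj /(congr1 val) /= e.
by apply: enum_rank_inj; apply: val_inj.
Qed.

(** * Maximum matching *)

Lemma card_ord_lt k c : (c <= k)%N -> #|[pred t : 'I_k | (t < c)%N]| = c.
Proof. by move=> le_ck; rewrite -sum1_card (big_ord_narrow le_ck) sum1_card card_ord. Qed.

Lemma card_setU_compl (I : finType) (x q : {set I}) :
  #|~: q :|: x| = (#|~: q| + #|x :&: q|)%N.
Proof.
have -> : ~: q :|: x = ~: q :|: (x :&: q).
  by apply/finset.setP => i; rewrite !inE; case: (i \in q); rewrite ?andbT.
apply/eqP; rewrite (leq_card_setU _ _).2; apply/pred0P => i /=.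
by rewrite !inE; case: (i \in q); rewrite ?andbF.
Qed.

(* Bit i is the first edge of the i-th path (i,0)-(i,1)-(i,2)-..., and at stage
   j the known part of this path has 2j edges, or 2j+1 if i is not queried.  A
   path with L edges has a matching of size ceil(L/2), so that the bit is
   visible in the first case only. *)
Lemma matching_encoding n T (I : finType) (Q : nat -> {set I}) :
  (0 < #|I|)%N -> (4 * #|I| ^ 2 <= n)%N -> (8 * #|I| ^ 2 <= T)%N ->
  exists2 enc : {set I} -> stream n T,
    forall x y, (hdist x y <= 1)%N -> neighboring (enc x) (enc y) &
    forall j, (j < #|I|)%N -> exists t c, forall x,
      max_matching (present (enc x) t) = (c + #|x :&: Q j|)%N.
Proof.
set k := #|I| => k0 le_n le_T; pose V := (I * 'I_(k.*2.+2))%type.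
have cardV : #|{: V}| = (k * k.*2.+2)%N by rewrite card_prod card_ord.
have leVn : (#|{: V}| <= n)%N by rewrite cardV; nia.
have [i0 _] := card_gt0P k0.
have [f f_inj _] := injection_to_ord (i0, ord0 : 'I_(k.*2.+2))
  (widen_ord leVn (enum_rank (i0, ord0 : 'I_(k.*2.+2)))) leVn.
pose phi j : rel V := fun a b =>
  [&& a.1 == b.1, b.2 == a.2.+1 :> nat & (1 <= a.2 <= j.*2 + (a.1 \notin Q j))%N].
have sub_phi j : subrel (phi j) (phi j.+1).
  move=> a b /and3P[ab1 ab2 /andP[a1 a2]]; rewrite /phi ab1 ab2 a1 /=.
  by apply: leq_trans a2 _; rewrite doubleS; case: (_ \notin Q j); lia.
have leT : (#|I| + #|[pred e | phi k.-1 e.1 e.2]| <= T)%N.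
  (* An edge is determined by its lower end, so there are at most [#|V|] of them. *)
  have inj : {in [pred e | phi k.-1 e.1 e.2] &, injective fst}.
    move=> [[i s] [i' s']] [[h u] [h' u']] /= /and3P[/= /eqP <- /eqP es _].
    move=> /and3P[/= /eqP <- /eqP eu _] [-> esu].
    have -> : s' = u' by apply: val_inj; rewrite /= es eu esu.
    by rewrite esu.
  rewrite -(card_in_image inj); apply: leq_trans le_T.
  by apply: (@leq_trans (k + #|{: V}|)); [rewrite leq_add2l max_card|rewrite cardV; nia].
pose s0 : 'I_(k.*2.+2) := inord 0; pose s1 : 'I_(k.*2.+2) := inord 1.
have [|enc enc1 encE] := graph_encoding (p := fun i => (i, s0))
  (q := fun i => (i, s1)) f_inj _ k0 sub_phi leT.
  by move=> i; apply/eqP => -[/(congr1 val)]; rewrite /= !inordK.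
exists enc => // j lt_j; have [|t tE] := encE j; first by rewrite -ltnS prednK.
exists t, (k * j + #|~: Q j|)%N => x; rewrite tE.
(* Path [i] has maximum matching size [j + b i]: the excess over [j] is 1 exactly when the bit is
   set or not queried. [B] has one element per matching edge. *)
pose b i := i \in ~: Q j :|: x.
pose B := [set a : I * 'I_k | (a.2 < j + b a.1)%N].
have cardB : #|B| = (k * j + #|~: Q j| + #|x :&: Q j|)%N.
  rewrite -addnA -card_setU_compl -sum1_card.
  under eq_bigl => a do rewrite finset.in_set.
  rewrite -(pair_big_dep xpredT (fun i (t : 'I_k) => (t < j + b i)%N)
    (fun _ _ => 1%N)) /=.
  under eq_bigr => i _ do rewrite sum1_card card_ord_lt
    ?(leq_trans _ lt_j) -?[j.+1]addn1 ?leq_add2l ?leq_b1 //.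
  rewrite big_split /= sum_nat_const; congr (_ + _)%N.
  by rewrite -sum1_card [RHS]big_mkcond.
have inB a : a \in B -> (a.2 < j + b a.1)%N /\ (a.2 < k)%N by rewrite inE.
rewrite -cardB; apply/eqP; rewrite eqn_leq; apply/andP; split.
  (* A vertex cover: the odd vertices up to [2j+1] if [b i] holds, otherwise the even vertices from
     2 to [2j], vertex 0 then having no edge. *)
  pose c (a : I * 'I_k) : V :=
    (a.1, inord (if b a.1 then a.2.*2.+1 else a.2.*2.+2)).
  apply: leq_trans (leq_imset_card c _); apply: max_matching_le => a d ad.
  have [le_d e2 e1] : [/\ (a.2 <= j.*2 + b a.1)%N, d.2 = a.2.+1 :> nat & d.1 = a.1].
    case/orP: ad => [/and3P[/eqP -> /eqP -> /andP[_]]|].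
      by move=> le_a; split=> //; apply: leq_trans le_a _;
        rewrite leq_add2l /b !inE; case: (_ \in Q j).
    by case/existsP => i /and3P[xi /eqP -> /eqP ->] /=; rewrite !inordK.
  have a1 : ~~ b a.1 -> (0 < a.2)%N.
    case/orP: ad => [/and3P[_ _ /andP[//]]|].
    by case/existsP => i /and3P[xi /eqP -> _]; rewrite /b !inE xi orbT.
  have mem (w : V) : w.1 = a.1 -> (w.2 <= j.*2 + (b a.1).*2)%N -> (0 < w.2)%N ->
      odd w.2 = b a.1 -> w \in [set c z | z in B].
    move=> w1 le_w w0 odd_w; have w2 := odd_double_half w.2.
    have bE : (b a.1 : nat) = odd w.2 by rewrite odd_w.
    have lt_r : ((w.2.-1)./2 < k)%N.
      by case: (odd w.2) bE w2 le_w => -> /=; lia.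
    apply/imsetP; exists (a.1, Ordinal lt_r); rewrite ?inE /=.
      by case: (odd w.2) bE w2 le_w => -> /=; lia.
    rewrite /c /= [LHS]surjective_pairing w1; congr (_, _); apply: val_inj.
    rewrite /= inordK; last by have := ltn_ord w.2; case: (b _); lia.
    by rewrite -odd_w; case: (odd w.2) w2 => /=; lia.
  (* The ends of an edge have opposite parities, so one of them lies in the cover. *)
  have [odd_a|odd_a] := eqVneq (odd a.2) (b a.1).
    apply/orP; left; apply: mem => //.
      by apply: leq_trans le_d _; rewrite leq_add2l; case: (b a.1).
    case: (b a.1) odd_a a1 => [odd_a _|_ ->] //.
    by case: (nat_of_ord a.2) odd_a.
  apply/orP; right; apply: mem => //; rewrite ?e2 //.
    by case: (b a.1) odd_a a1 le_d => /=; lia.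
  by rewrite /=; case: (odd _) odd_a; case: (b _).
(* A matching of the same size: every second edge, starting with the bit edge if present and at
   vertex 1 otherwise. *)
pose p (a : I * 'I_k) : V := (a.1, inord (if a.1 \in x then a.2.*2 else a.2.*2.+1)).
pose q (a : I * 'I_k) : V := (a.1, inord (if a.1 \in x then a.2.*2.+1 else a.2.*2.+2)).
have p2 (a : I * 'I_k) :
    (p a).2 = (if a.1 \in x then a.2.*2 else a.2.*2.+1) :> nat.
  by rewrite /= inordK //; have := ltn_ord a.2; case: ifP; lia.
have q2 (a : I * 'I_k) :
    (q a).2 = (if a.1 \in x then a.2.*2.+1 else a.2.*2.+2) :> nat.
  by rewrite /= inordK //; have := ltn_ord a.2; case: ifP; lia.
apply: (max_matching_ge f_inj (p := p) (q := q)).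
- move=> [i s] [h u] _ _ e; have eih : i = h := congr1 fst e.
  have := p2 (i, s); rewrite e p2 -eih /= => esu.
  by rewrite eih; congr (_, _); apply: val_inj => /=; case: ifP esu; lia.
- move=> [i s] [h u] _ _ e; have eih : i = h := congr1 fst e.
  have := q2 (i, s); rewrite e q2 -eih /= => esu.
  by rewrite eih; congr (_, _); apply: val_inj => /=; case: ifP esu; lia.
- move=> [i s] [h u] _ _; apply/eqP => e; have eih : i = h := congr1 fst e.
  by have := p2 (i, s); rewrite e q2 -eih /=; case: ifP; lia.
- move=> a /inB[lt_a _]; rewrite /phi p2 q2 /=.
  case: (boolP (a.1 \in x)) => xa; last first.
    apply/orP; left; rewrite !eqxx /=; move: lt_a; rewrite /b !inE (negPf xa) orbF.
    by case: (_ \notin _) => /=; lia.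
  have [a0|a0] := posnP a.2.
    apply/orP; right; apply/existsP; exists a.1; rewrite xa /p /q xa a0 /=.
    by rewrite !eqxx.
  by apply/orP; left; rewrite !eqxx double_gt0 a0 /=; move: lt_a;
    case: (b _); case: (_ \notin _) => /=; lia.
Qed.

(** * Degree histogram *)

Lemma degree_histogramE (V : finType) n (f : V -> 'I_n) (phi : rel V)
    (j : 'I_n.-1) : injective f -> irreflexive phi ->
  degree_histogram (fun e => e \in edges_of f phi) j =
  #|[set a | #|[set b | phi a b || phi b a]| == j.+1]|.
Proof.
move=> f_inj irr; rewrite -(card_imset _ f_inj).
apply: eq_card => v; rewrite mem_mkset; apply/eqP/imsetP => [deg|[a]].
  have [/existsP[a /eqP av]|/existsPn nov] := boolP [exists a, f a == v].
    by exists a => //; rewrite inE -(degree_edges_of f_inj) // av deg.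
  by move: deg; rewrite degree_edges_of0.
by rewrite inE => /eqP deg ->; rewrite degree_edges_of.
Qed.

(* The bits are the edges between inl i and inr (inl i).  At stage j, the vertex
   inl i has j + 2 neighbours inr (inr t), plus one if i is not queried, plus
   one if the bit i is set.  Hence it has degree j + 2 if i is queried and not
   set, and the degrees of all other vertices that may be at least 2 are
   independent of the database. *)
Lemma histogram_encoding n T (I : finType) (Q : nat -> {set I}) :
  (1 < #|I|)%N -> (4 * #|I| <= n)%N -> (8 * #|I| ^ 2 <= T)%N ->
  exists2 enc : {set I} -> stream n T,
    forall x y, (hdist x y <= 1)%N -> neighboring (enc x) (enc y) &
    forall j, (j < #|I|)%N -> exists t (r : 'I_n.-1) c, forall x,
      (degree_histogram (present (enc x) t) r + #|x :&: Q j|)%N = c.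
Proof.
set k := #|I| => k1 le_n le_T; pose V := (I + (I + 'I_k.+2))%type.
have cardV : #|{: V}| = (k + (k + k.+2))%N by rewrite !card_sum card_ord.
have leVn : (#|{: V}| <= n)%N by rewrite cardV; lia.
have [i0 _] : exists i : I, i \in I by apply/card_gt0P; apply: ltnW.
have [f f_inj _] := injection_to_ord (inl i0 : V)
  (widen_ord leVn (enum_rank (inl i0 : V))) leVn.
pose phi j : rel V := fun a b =>
  match a, b with
  | inl i, inr (inr t) => (t < j.+2 + (i \notin Q j))%N
  | _, _ => false
  end.
have sub_phi j : subrel (phi j) (phi j.+1).
  move=> [i|?] [//|[//|t]] //= lt_t; apply: leq_trans lt_t _.
  by case: (_ \notin Q j); case: (_ \notin Q j.+1); lia.
have leT : (#|I| + #|[pred e | phi k.-1 e.1 e.2]| <= T)%N.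
  apply: leq_trans le_T.
  apply: (@leq_trans (k + #|{: I * 'I_k.+2}|)); last first.
    by rewrite card_prod card_ord -/k; nia.
  rewrite leq_add2l -(@card_imset _ _ (fun p => (inl p.1, inr (inr p.2)) : V * V)).
    apply: subset_leq_card; apply/fintype.subsetP => -[[i|?] [//|[//|t]]] //= _.
    by apply/imsetP; exists (i, t).
  by move=> [? ?] [? ?] /= [-> ->].
have [||enc enc1 encE] := graph_encoding (p := fun i : I => inl i : V)
  (q := fun i => inr (inl i) : V) f_inj _ _ sub_phi leT; rewrite -/k ?(ltnW k1) //.
exists enc => // j lt_j; have [|t tE] := encE j; first by rewrite -ltnS prednK // ltnW.
(* Coordinate [j.+1] of the histogram counts the vertices of degree [j.+2]. *)
have lt_r : (j.+1 < n.-1)%N by lia.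
pose psi (x : {set I}) : rel V := fun a b =>
  phi j a b || [exists i in x, (a == inl i) && (b == inr (inl i))].
have irr x : irreflexive (psi x).
  move=> a; rewrite /psi; apply/negP => /orP[|/existsP[i /and3P[_ /eqP -> //]]].
  by case: a => [?|[?|?]].
pose deg (x : {set I}) (a : V) := #|[set b | psi x a b || psi x b a]|.
have deg_u x i : deg x (inl i) = (j.+2 + (i \notin Q j) + (i \in x))%N.
  rewrite -[(j.+2 + _)%N](@card_ord_lt k.+2); last first.
    by case: (_ \notin Q j); lia.
  have inrr_inj : injective (fun t => inr (inr t) : V) by move=> ? ? [].
  rewrite -(card_imset _ inrr_inj); set A := imset _ _.
  have -> : (i \in x : nat) = #|[set (inr (inl i) : V) | _ in [pred _ : unit | i \in x]]|.
    case: (i \in x) => /=; last first.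
      by apply/esym/eq_card0 => b; apply/negP => /imsetP[].
    rewrite -(cards1 (inr (inl i) : V)); apply: eq_card => b; rewrite inE.
    by apply/eqP/imsetP => [->|[]//]; exists tt.
  set B := imset _ _.
  have /eqP <- : #|A :|: B| == (#|A| + #|B|)%N.
    rewrite (leq_card_setU A B).2; apply/pred0P => d; apply/negP.
    by case/andP=> /imsetP[s _ ->] /imsetP[].
  apply: eq_card => b; rewrite finset.in_setU inE /psi.
  apply/idP/orP => [|[/imsetP[s ls ->]|/imsetP[? xi ->]]].
  - case/orP=> /orP[|/existsP[h /and3P[xh /eqP e1 /eqP e2]]] //.
    + case: b => [?|[?|s]] //= ls; left; by apply/imsetP; exists s.
    + by right; apply/imsetP; exists tt; case: e1 => ->.
    + by case: b => [?|[?|?]].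
  - by rewrite /=; move: ls; rewrite inE => ->.
  - apply/orP; left; apply/orP; right; apply/existsP; exists i.
    by rewrite !eqxx; move: xi; rewrite inE => ->.
have deg_w x i : (deg x (inr (inl i)) <= 1)%N.
  rewrite -(cards1 (inl i : V)); apply: subset_leq_card.
  apply/fintype.subsetP => b; rewrite !inE /psi.
  case/orP=> /orP[|/existsP[h /and3P[xh /eqP e1 /eqP e2]]] //.
    by case: b => [?|[?|s]].
  by case: e2 => ->; rewrite e1.
have deg_c x s : deg x (inr (inr s)) = deg finset.set0 (inr (inr s)).
  apply: eq_card => b; rewrite !inE /psi; congr (_ || _); congr (_ || _);
    apply/existsP/existsP => -[h /and3P[_ /eqP e1 /eqP e2]] //.
exists t, (Ordinal lt_r), (#|Q j| +
  #|[set s | deg finset.set0 (inr (inr s)) == j.+2]|)%N => x.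
rewrite tE (degree_histogramE _ f_inj (irr x)) /=.
have split_sum (p : pred V) : #|[set a | p a]| =
    (#|[set i | p (inl i)]| + (#|[set i | p (inr (inl i))]| +
     #|[set s | p (inr (inr s))]|))%N.
  rewrite -!sum1_card !(big_mkcond (fun i => i \in _)) /= !big_sumType /=.
  by congr (_ + (_ + _))%N; apply: eq_bigr => ? _; rewrite !inE.
rewrite split_sum [X in (_ + (X + _))%N]eq_card0 => [|i]; last first.
  by rewrite inE; apply/eqP => e; have := deg_w x i; rewrite /deg /psi e.
rewrite add0n [X in (_ + X + _)%N](_ : _ =
    #|[set s | deg finset.set0 (inr (inr s)) == j.+2]|); last first.
  by apply: eq_card => s; rewrite [LHS]finset.in_set [RHS]finset.in_set -(deg_c x).
rewrite addnAC; congr (_ + _)%N.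
(* The vertices [inl i] of degree [j.+2] are the queried ones with unset bit; together with the
   query answer they make up [#|Q j|]. *)
rewrite [X in (X + _)%N](_ : _ = #|Q j :\: x|); last first.
  apply: eq_card => i; rewrite [LHS]finset.in_set -[X in X == _]/(deg x (inl i)) deg_u.
  rewrite finset.in_setD; case: (i \in Q j); case: (i \in x);
    rewrite /= ?addn0 ?addn1; lia.
by rewrite addnC finset.setIC cardsID.
Qed.

(** * Core number *)

Lemma in_k_subgraphP (V : finType) n (f : V -> 'I_n) (phi : rel V) a k :
  injective f -> irreflexive phi ->
  reflect (exists S : {set V}, a \in S /\ {in S, forall b,
             (k <= #|[set c in S | phi b c || phi c b]|)%N})
    (in_k_subgraph (fun e => e \in edges_of f phi) (f a) k).
Proof.
move=> f_inj irr.
have card_in (S : {set V}) b : b \in S ->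
    #|[set c in S | phi b c || phi c b]| = #|[set e in edges_of f
      (fun u w => [&& phi u w, u \in S & w \in S]) | f b \in val e]|.
  move=> bS; rewrite card_incident // => [|u]; last by rewrite irr.
  by apply: eq_card => c; rewrite !inE bS !andbT /= andb_orr !(andbC (c \in S)).
apply: (iffP existsP) => [[S /existsP[F]]|[S [aS deg]]].
  case/and3P=> aS /forall_inP sub /forall_inP deg.
  exists (f @^-1: S); split=> [|b]; first by rewrite inE.
  move=> bS; rewrite (card_in _ _ bS).
  have := deg (f b); rewrite inE in bS => /(_ bS)/leq_trans; apply.
  apply: subset_leq_card; apply/fintype.subsetP => e; rewrite !inE.
  case/andP=> eF be; rewrite be andbT.
  have /andP[/edges_ofP[u [w [uw ee]]] /fintype.subsetP eS] := sub e eF.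
  have uS : f u \in S by apply: eS; rewrite ee !inE eqxx.
  have wS : f w \in S by apply: eS; rewrite ee !inE eqxx orbT.
  apply/existsP; exists u; apply/existsP; exists w.
  by rewrite !inE uw uS wS ee eqxx.
exists (f @: S); apply/existsP.
exists (edges_of f (fun u w => [&& phi u w, u \in S & w \in S])).
apply/and3P; split; first exact: imset_f.
  apply/forall_inP => e /edges_ofP[u [w [/and3P[uw uS wS] ee]]].
  apply/andP; split; first by apply/edges_ofP; exists u, w.
  apply/fintype.subsetP => z; rewrite ee !inE.
  by case/orP=> /eqP ->; apply: imset_f.
by apply/forall_inP => z /imsetP[b bS ->]; rewrite -card_in // deg.
Qed.

Lemma core_number_eq n (G : pred (edge n)) v k : (k < n)%N ->
  in_k_subgraph G v k -> (forall h, in_k_subgraph G v h -> (h <= k)%N) ->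
  core_number G v = k.
Proof.
move=> lt_kn Gk maxk; apply/eqP; rewrite eqn_leq; apply/andP; split.
  by apply/bigmax_leqP => h /maxk.
exact: (@leq_bigmax_cond _ _ _ (Ordinal lt_kn)).
Qed.

(* The vertex v = None has 1 + j(k+1) neighbours in a large clique at stage j,
   plus one neighbour Some (inl i) for each bit i of the database.  The latter
   have j(k+1) neighbours in the clique, which is too few to lie in a core that
   raises v above its base value, or (j+1)(k+1) if they are queried. *)
Lemma core_encoding n T (v : 'I_n) (I : finType) (Q : nat -> {set I}) :
  (1 < #|I|)%N -> (4 * #|I| ^ 2 <= n)%N -> (32 * #|I| ^ 4 <= T)%N ->
  exists2 enc : {set I} -> stream n T,
    forall x y, (hdist x y <= 1)%N -> neighboring (enc x) (enc y) &
    forall j, (j < #|I|)%N -> exists t c, forall x,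
      core_number (present (enc x) t) v = (c + #|x :&: Q j|)%N.
Proof.
set k := #|I| => k1 le_n le_T.
(* A clique vertex then has degree at least [k * k.+1], which is the largest target
   [1 + j * k.+1 + k] over [j < k]. *)
pose z := (k ^ 2 + k + 1)%N; pose V := option (I + 'I_z).
have cardV : #|{: V}| = (k + z).+1 by rewrite card_option card_sum card_ord.
have leVn : (#|{: V}| <= n)%N by rewrite cardV /z; nia.
have [f f_inj <-] := injection_to_ord (None : V) v leVn.
(* The spacing [k.+1] leaves room for all answers up to [k]: a queried vertex has
   [j.+1 * k.+1 = 1 + j * k.+1 + k] clique neighbours, while an unqueried one, counting [v], has
   degree at most [1 + j * k.+1]. *)
pose phi j : rel V := fun a b =>
  match a, b with
  | None, Some (inr s) => (s < 1 + j * k.+1)%N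
  | Some (inl i), Some (inr s) => (s < (j + (i \in Q j)) * k.+1)%N
  | Some (inr s), Some (inr t) => (s < t)%N
  | _, _ => false
  end.
have sub_phi j : subrel (phi j) (phi j.+1).
  move=> [[i|s]|] [[h|t]|] //= lt_t; apply: leq_trans lt_t _.
    by rewrite leq_mul2r; case: (i \in Q j); lia.
  by rewrite leq_add2l leq_mul2r leqnSn.
have leT : (#|I| + #|[pred e | phi k.-1 e.1 e.2]| <= T)%N.
  apply: leq_trans le_T.
  have := max_card [pred e | phi k.-1 e.1 e.2]; rewrite card_prod cardV -/k.
  have : (k + z <= 3 * k ^ 2)%N by rewrite /z; nia.
  set w := #|_|; move=> le_z le_w.
  have : ((k + z).+1 * (k + z).+1 <= (4 * k ^ 2) * (4 * k ^ 2))%N.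
    by apply: leq_mul; nia.
  by have : (k <= k ^ 4)%N; [rewrite -{1}(expn1 k) leq_pexp2l //; lia|];
    rewrite (_ : k ^ 4 = k ^ 2 * k ^ 2)%N -?expnD //; nia.
have [||enc enc1 encE] := graph_encoding (p := fun i : I => None : V)
  (q := fun i => Some (inl i) : V) f_inj _ _ sub_phi leT; rewrite -/k ?(ltnW k1) //.
exists enc => // j lt_j; have [|t tE] := encE j; first by rewrite -ltnS prednK // ltnW.
exists t, (1 + j * k.+1)%N => x; rewrite tE; set psi : rel V := fun a b => _.
have le_q : (#|x :&: Q j| <= k)%N by apply: max_card.
have irr : irreflexive psi.
  move=> a; rewrite /psi; apply/negP => /orP[|/existsP[i /and3P[_ /eqP -> //]]].
  by case: a => [[i|s]|] //=; rewrite ltnn.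
have card_clique c : (c <= z)%N ->
    #|[set (Some (inr s) : V) | s in [pred s : 'I_z | (s < c)%N]]| = c.
  by move=> le_c; rewrite card_imset ?card_ord_lt // => s u [].
have jk : (j.+1 * k.+1 <= k * k.+1)%N by rewrite leq_mul2r lt_j orbT.
apply: core_number_eq => [||h /(in_k_subgraphP _ _ f_inj irr)[S [vS deg]]].
- by move: jk le_n; rewrite mulSn !mulnS -mulnn; nia.
(* Lower bound: the clique, [v], and the queried vertices whose bit is set. *)
- pose S := [set a : V | match a with
    | Some (inl i) => i \in x :&: Q j | _ => true end].
  apply/(in_k_subgraphP _ _ f_inj irr); exists S; split; first by rewrite inE.
  have clique c a : (c <= z)%N ->
      (forall s : 'I_z, (s < c)%N -> psi a (Some (inr s))) ->
      (c <= #|[set d in S | psi a d || psi d a]|)%N.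
    move=> le_cz adj; rewrite -{1}(card_clique _ le_cz); apply: subset_leq_card.
    by apply/fintype.subsetP => ? /imsetP[s ls ->]; rewrite !inE adj.
  move=> [[i|s]|]; rewrite inE => aS.
  + apply: leq_trans (clique (j.+1 * k.+1)%N _ _ _); first by rewrite mulSn; lia.
      by rewrite /z; move: jk; rewrite -mulnn; nia.
    move: aS; rewrite inE => /andP[_ iQ] s ls.
    by rewrite /psi /= iQ addn1 ls.
  + apply: (@leq_trans #|[set (Some (inr u) : V) | u in [set~ s]]|).
      rewrite card_imset => [|? ? [] //]; rewrite cardsC1 card_ord /z addn1 /=.
      by move: jk; rewrite mulSn -mulnn; nia.
    apply: subset_leq_card; apply/fintype.subsetP => ? /imsetP[u us ->].
    rewrite !inE /psi /=; move: us; rewrite !inE -val_eqE /=.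
    by case: (ltngtP s u) => //; rewrite ?orbT.
  + have le_z : (1 + j * k.+1 <= z)%N.
      by rewrite /z; move: jk; rewrite mulSn -mulnn; nia.
    have inl_inj : injective (fun i => Some (inl i) : V) by move=> ? ? [].
    have := card_clique _ le_z; set A := imset _ _ => cA.
    have := card_imset (x :&: Q j) inl_inj; set B := imset _ _ => cB.
    rewrite -{1}cA -cB.
    have /eqP <- : #|A :|: B| == (#|A| + #|B|)%N.
      rewrite (leq_card_setU A B).2; apply/pred0P => d; apply/negP.
      by case/andP=> /imsetP[s _ ->] /imsetP[i _].
    apply: subset_leq_card; apply/fintype.subsetP => d.
    rewrite finset.in_setU => /orP[/imsetP[s ls ->]|/imsetP[i iQ ->]].
      by rewrite !inE /psi /=; move: ls; rewrite inE => ->.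
    rewrite !inE -finset.in_setI iQ /= /psi /=; apply/orP; left.
    by apply/existsP; exists i; move: iQ; rewrite !inE !eqxx => /andP[->].
(* Upper bound: a core above the claimed value contains no unqueried bit vertex, their degree being
   too small, and this limits the neighbours left to [v]. *)
- rewrite leqNgt; apply/negP => lt_h.
  have notQ i : Some (inl i) \in S -> i \in Q j.
    move=> /deg le_h; apply: contraLR lt_h => niQ; rewrite -leqNgt.
    apply: (leq_trans le_h); rewrite -addnA addnC -addnA addnC.
    apply: (@leq_trans (j * k.+1 + 1)%N); last by lia.
    rewrite -(@card_clique (j * k.+1)%N); last first.
      by rewrite /z; move: jk; rewrite mulSn -mulnn; nia.
    rewrite -(cards1 (None : V)); apply: leq_trans (leq_card_setU _ _).
    apply: subset_leq_card; apply/fintype.subsetP => d.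
    rewrite 2!inE /psi => /andP[_].
    case/orP=> /orP[|/existsP[i' /and3P[_ /eqP d1 /eqP d2]]] //.
    + case: d => [[i'|s]|] //= ls; apply/orP; left.
      by apply/imsetP; exists s; move: ls; rewrite ?inE (negPf niQ) addn0.
    + by case: d => [[i'|s]|].
    + by rewrite d1 !inE eqxx orbT.
  move: lt_h; rewrite ltnNge => /negP; apply; apply: leq_trans (deg _ vS) _.
  rewrite -(@card_clique (1 + j * k.+1)%N); last first.
    by rewrite /z; move: jk; rewrite mulSn -mulnn; nia.
  have inl_inj : injective (fun i => Some (inl i) : V) by move=> ? ? [].
  rewrite -(card_imset (x :&: Q j) inl_inj).
  apply: leq_trans (leq_card_setU _ _).
  apply: subset_leq_card; apply/fintype.subsetP => d.
  rewrite 2!inE /psi => /andP[dS].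
  case/orP=> /orP[|/existsP[i' /and3P[xi /eqP d1 /eqP d2]]] //.
  + case: d dS => [[i'|s]|] //= dS ls; apply/orP; left.
    by apply/imsetP; exists s; rewrite ?inE.
  + apply/orP; right; apply/imsetP; exists i' => //.
    by rewrite inE xi notQ // -d2.
  + by case: d dS => [[i'|s]|].
Qed.

(** * Error bounds *)

(** If one output is accurate for two databases, their answers differ by at most [2 * alpha], so
    their distance is at most [36 * alpha ^+ 2]; and 15 times 36 is 540. Absolute differences let
    the answer enter with either sign. *)
Lemma encoding_error_bound (R : realType) d (Omega : measurableType d)
    (P : probability Omega R) n T m
    (M : Omega -> stream n T -> 'I_T -> 'I_m -> R) (g : stream n T -> 'I_T -> 'I_m -> R)
    (eps delta alpha : R) l (enc : {set {set 'I_l}} -> stream n T) :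
  0 <= eps <= 1 -> delta <= 3^-1 -> measurable_mech_vec M -> dp P M eps delta ->
  exact_accurate_vec P M g alpha ->
  (forall x y, (hdist x y <= 1)%N -> neighboring (enc x) (enc y)) ->
  (forall A, exists t r, forall x y,
     `|#|x :&: walsh_query A|%:R - #|y :&: walsh_query A|%:R|
       <= `|g (enc x) t r - g (enc y) t r|) ->
  0 <= alpha /\ (2 ^ l)%:R <= 540 * alpha ^+ 2 + 12.
Proof.
move=> eps01 delta3 mM dpM accM enc1 encQ.
pose acc x : set ('I_T -> 'I_m -> R) := [set o | forall t r,
  g (enc x) t r - alpha <= o t r <= g (enc x) t r + alpha]%classic.
have mB x y : measurable ((fun w => M w (enc x)) @^-1` acc y)%classic.
  have -> : ((fun w => M w (enc x)) @^-1` acc y = \bigcap_(t in setT)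
      \bigcap_(r in setT) ((fun w => M w (enc x) t r) @^-1`
        `[(g (enc y) t r - alpha)%R, (g (enc y) t r + alpha)%R]))%classic.
    apply/seteqP; split => [w aw t _ r _|w aw t r]; rewrite /= ?in_itv /=.
      exact: (aw t r).
    by have := aw t I r I; rewrite /= in_itv.
  apply: fin_bigcap_measurable => // t _; apply: fin_bigcap_measurable => // r _.
  by rewrite -[X in measurable X]setTI; apply: mM => //; exact: measurable_itv.
(* Accuracy has positive probability, so some output lies in the intervals of radius [alpha], which
   are thus nonempty. *)
have alpha0 : 0 <= alpha.
  have [t [r _]] := encQ finset.set0.
  have [[w aw]|none] := pselect (exists w, acc finset.set0 (M w (enc finset.set0))).
    by have /andP[? ?] := aw t r; lra.
  have := accM (enc finset.set0); rewrite [X in P X](_ : _ = set0) ?measure0.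
    by rewrite lee_fin => ?; lra.
  by apply/seteqP; split => // w aw; case: none; exists w.
split=> //.
have {1}-> : (2 ^ l)%N = #|{set 'I_l}|.
  by rewrite -finset.cardsT -powersetT card_powerset finset.cardsT card_ord.
have -> : 540 * alpha ^+ 2 + 12 = 15 * (9 * (2 * alpha) ^+ 2) + 12 by ring.
apply: (@dp_reconstruction_bound R d Omega P n T _ M eps delta _ _ enc acc) => //.
- by rewrite mulr_ge0 // exprn_ge0 // mulr_ge0.
- by move=> x; apply: accM.
- move=> o x y ax ay; apply: hadamard_reconstruction => A.
  have [t [r close]] := encQ A; apply: le_trans (close x y) _.
  have /andP[? ?] := ax t r; have /andP[? ?] := ay t r.
  by rewrite ler_norml; apply/andP; split; lra.
Qed.

Definition walsh_queries l j : {set {set 'I_l}} :=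
  walsh_query (nth finset.set0 (enum {set 'I_l}) j).

Lemma walsh_queriesP l (A : {set 'I_l}) :
  exists2 j, (j < #|{set 'I_l}|)%N & walsh_queries l j = walsh_query A.
Proof. by exists (enum_rank A) => //; rewrite /walsh_queries nth_enum_rank. Qed.

(** Since [2 ^ l] is at least 32, the term 12 is less than half of it. *)
Lemma scale_bound (R : realType) (alpha : R) l : (5 <= l)%N ->
  (2 ^ l)%:R <= 540 * alpha ^+ 2 + 12 -> (2 ^ l)%:R <= 1080 * alpha ^+ 2.
Proof.
move=> l5 le_l; have : (2 ^ 5)%:R <= (2 ^ l)%:R :> R by rewrite ler_nat leq_pexp2l.
by rewrite [(2 ^ 5)%:R](_ : _ = 32) //; lra.
Qed.

Lemma scalar_error_bound (R : realType) d (Omega : measurableType d)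
    (P : probability Omega R) n T (M : Omega -> stream n T -> 'I_T -> R)
    (h : pred (edge n) -> nat) (eps delta alpha : R) l : (5 <= l)%N ->
  0 <= eps <= 1 -> delta <= 3^-1 -> measurable_mech M -> dp P M eps delta ->
  exact_accurate P M (fun u t => (h (present u t))%:R) alpha ->
  (exists2 enc : {set {set 'I_l}} -> stream n T,
    forall x y, (hdist x y <= 1)%N -> neighboring (enc x) (enc y) &
    forall j, (j < #|{set 'I_l}|)%N -> exists t c, forall x,
      h (present (enc x) t) = (c + #|x :&: walsh_queries l j|)%N) ->
  0 <= alpha /\ (2 ^ l)%:R <= 1080 * alpha ^+ 2.
Proof.
move=> l5 eps01 delta3 mM dpM accM [enc enc1 encE].
have [||||alpha0 /(scale_bound l5)//] := @encoding_error_bound R d Omega P n T 1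
  (fun w u t _ => M w u t) (fun u t _ => (h (present u t))%:R) eps delta alpha l
  enc eps01 delta3 _ _ _ enc1.
- by move=> u t r; exact: mM.
- by move=> u v nb S; apply: (dpM u v nb [set o | S (fun t _ => o t)]%classic).
- move=> u; apply: le_trans (accM u) _; rewrite le_eqVlt; apply/orP; left.
  apply/eqP; congr (P _); apply/seteqP.
  by split => [w aw t _|w aw t]; [apply: (aw t)|apply: (aw t ord0)].
- move=> A; have [j /encE[t [c cE]] <-] := walsh_queriesP A; exists t, ord0 => x y.
  by rewrite !cE !natrD le_eqVlt; apply/orP; left; apply/eqP; congr `| _ |; ring.
Qed.

(** Selects the largest database that fits; the failure of the next scale is what bounds [n] or [T]
    from above. *)
Lemma largest_scale (p : pred nat) N : p 5 -> (forall l, p l -> (2 ^ l <= N)%N) ->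
  exists l, [/\ (5 <= l)%N, p l & ~~ p l.+1].
Proof.
move=> p5 bound; have ex : exists l, p l by exists 5.
have le_N l : p l -> (l <= N)%N.
  by move=> /bound; apply: leq_trans; apply: ltnW; apply: ltn_expl.
case: (ex_maxnP ex le_N) => l pl maxl; exists l; split=> //; first exact: maxl.
by apply/negP => /maxl; rewrite ltnn.
Qed.

Lemma root_bound (R : realType) (x alpha : R) m : (0 < m)%N -> 0 <= x ->
  0 <= alpha -> x <= (100 * alpha) ^+ m -> 100^-1 * x `^ (m%:R^-1) <= alpha.
Proof.
move=> m0 x0 alpha0 le_x; have a0 : 0 <= 100 * alpha by apply: mulr_ge0.
have m0' : m%:R != 0 :> R by rewrite pnatr_eq0 -lt0n.
rewrite mulrC ler_pdivrMr // mulrC.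
have -> : 100 * alpha = ((100 * alpha) ^+ m) `^ m%:R^-1.
  by rewrite -powR_mulrn // -powRrM mulfV // powRr1.
by apply: ge0_ler_powR; rewrite ?nnegrE ?invr_ge0 ?exprn_ge0.
Qed.

(** Here [N] is the resource, [n] or [T], too small for a database of size [2 * k], while privacy
    bounds [k] by a multiple of [alpha ^+ 2]. *)
Lemma natr_scale_le (R : realType) (alpha K L : R) C N m k :
  0 <= alpha -> 0 <= K -> k%:R <= K * alpha ^+ 2 -> (N < C * (2 * k) ^ m)%N ->
  C%:R * (2 * K) ^+ m <= L ^+ (2 * m) -> N%:R <= (L * alpha) ^+ (2 * m).
Proof.
move=> alpha0 K0 le_k /ltnW le_N le_C.
have := le_N; rewrite -(ler_nat R) natrM natrX natrM.
move=> /le_trans; apply; rewrite [leRHS]exprMn.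
apply: (@le_trans _ _ (C%:R * (2 * K * alpha ^+ 2) ^+ m)).
  rewrite ler_wpM2l // lerXn2r // ?nnegrE ?mulr_ge0 // ?exprn_ge0 //.
  by rewrite -mulrA ler_wpM2l.
by rewrite exprMn -exprM mulrA ler_wpM2r // exprn_ge0.
Qed.

Local Open Scope classical_set_scope.
Local Open Scope ring_scope.

Theorem theorem1 (R : realType) :
  (* (i) maximum matching *)
  (exists (c : R) (N0 : nat), 0 < c /\
    forall (n T : nat) (d : measure_display) (Omega : measurableType d)
           (P : probability Omega R) (M : Omega -> stream n T -> 'I_T -> R)
           (eps delta alpha : R),
      (N0 <= n)%N -> (N0 <= T)%N ->
      0 <= eps <= 1 -> 0 <= delta <= 3^-1 ->
      online M -> measurable_mech M -> dp P M eps delta ->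
      exact_accurate P M (fun u t => (max_matching (present u t))%:R) alpha ->
      c * Num.min (T%:R `^ (4^-1)) (n%:R `^ (4^-1)) <= alpha) /\
  (* (ii) degree histogram, l_infinity error *)
  (exists (c : R) (N0 : nat), 0 < c /\
    forall (n T : nat) (d : measure_display) (Omega : measurableType d)
           (P : probability Omega R)
           (M : Omega -> stream n T -> 'I_T -> 'I_n.-1 -> R)
           (eps delta alpha : R),
      (N0 <= n)%N -> (N0 <= T)%N ->
      0 <= eps <= 1 -> 0 <= delta <= 3^-1 ->
      online M -> measurable_mech_vec M -> dp P M eps delta ->
      exact_accurate_vec P M
        (fun u t j => (degree_histogram (present u t) j)%:R) alpha ->
      c * Num.min (T%:R `^ (4^-1)) (n%:R `^ (2^-1)) <= alpha) /\
  (* (iii) core number of a fixed vertex v *)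
  (exists (c : R) (N0 : nat), 0 < c /\
    forall (n T : nat) (v : 'I_n) (d : measure_display)
           (Omega : measurableType d)
           (P : probability Omega R) (M : Omega -> stream n T -> 'I_T -> R)
           (eps delta alpha : R),
      (N0 <= n)%N -> (N0 <= T)%N ->
      0 <= eps <= 1 -> 0 <= delta <= 3^-1 ->
      online M -> measurable_mech M -> dp P M eps delta ->
      exact_accurate P M (fun u t => (core_number (present u t) v)%:R) alpha ->
      c * Num.min (T%:R `^ (8^-1)) (n%:R `^ (4^-1)) <= alpha).
Proof.
have c0 : 0 < 100^-1 :> R by rewrite invr_gt0.
have cardI l : #|{set 'I_l}| = (2 ^ l)%N.
  by rewrite -finset.cardsT -powersetT card_powerset finset.cardsT card_ord.
have K0 : 0 <= 1080 :> R by exact: ler0n.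
split; last split.
(* The threshold is the size required at [l = 5]; 100 is large enough for the numerical inequalities
   [C2], [C4] and [C8] below. *)
- exists 100^-1, (8 * (2 ^ 5) ^ 2)%N; split=> [//|n T d Omega P M eps delta alpha].
  move=> n0 T0 eps01 /andP[_ delta3] _ mM dpM accM.
  pose p l := (8 * (2 ^ l) ^ 2 <= minn n T)%N.
  have [||l [l5 pl npl]] := @largest_scale p n.
  + by rewrite /p leq_min n0 T0.
  + by move=> l; rewrite /p leq_min => /andP[? _]; nia.
  have [pn pT] : (4 * (2 ^ l) ^ 2 <= n)%N /\ (8 * (2 ^ l) ^ 2 <= T)%N.
    by move: pl; rewrite /p leq_min => /andP[? ?]; split => //; lia.
  have [|alpha0 le_l] := scalar_error_bound l5 eps01 delta3 mM dpM accM.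
    by apply: matching_encoding; rewrite cardI ?expn_gt0.
  have C4 : 8%:R * (2 * 1080) ^+ 2 <= 100 ^+ (2 * 2) :> R.
    by rewrite !exprS expr0; lra.
  have root_le N : (N < 8 * (2 * 2 ^ l) ^ 2)%N -> 100^-1 * N%:R `^ (4^-1) <= alpha.
    by move=> lt_N; apply: root_bound => //; apply: natr_scale_le K0 le_l lt_N C4.
  rewrite (minr_pMr _ _ (ltW c0)) ge_min; apply/orP.
  (* Scale [l.+1] fails because of [n] or of [T], and the corresponding term of the minimum gets
     bounded. *)
  have := npl; rewrite /p leq_min negb_and -!ltnNge (expnS 2).
  by case/orP => h; [right|left]; apply: root_le.
- exists 100^-1, (8 * (2 ^ 5) ^ 2)%N; split=> [//|n T d Omega P M eps delta alpha].
  move=> n0 T0 eps01 /andP[_ delta3] _ mM dpM accM.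
  (* With [2 ^ l] of order [alpha ^+ 2], the linear need for vertices gives a square root and the
     quadratic need for time a fourth root. *)
  pose p l := (4 * 2 ^ l <= n)%N && (8 * (2 ^ l) ^ 2 <= T)%N.
  have [||l [l5 /andP[pn pT] npl]] := @largest_scale p n.
  + by rewrite /p T0 andbT; apply: leq_trans n0.
  + by move=> l; rewrite /p => /andP[? _]; lia.
  have [|||enc enc1 encE] := @histogram_encoding n T _ (@walsh_queries l);
    rewrite ?cardI //; first by rewrite (ltn_exp2l 0) // (leq_trans _ l5).
  have [|alpha0 /(scale_bound l5) le_l] :=
      @encoding_error_bound R d Omega P n T _ M _ eps delta alpha l enc
        eps01 delta3 mM dpM accM enc1.
    move=> A; have [j /encE[t [r [c cE]]] <-] := walsh_queriesP A.
    exists t, r => x y; have := etrans (cE x) (esym (cE y)).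
    move=> /(congr1 (fun N : nat => N%:R : R)); rewrite !natrD => e.
    rewrite [leRHS]distrC le_eqVlt; apply/orP; left; apply/eqP.
    by congr `| _ |; lra.
  have C2 : 4%:R * (2 * 1080) ^+ 1 <= 100 ^+ (2 * 1) :> R.
    by rewrite !exprS expr0; lra.
  have C4 : 8%:R * (2 * 1080) ^+ 2 <= 100 ^+ (2 * 2) :> R.
    by rewrite !exprS expr0; lra.
  rewrite (minr_pMr _ _ (ltW c0)) ge_min; apply/orP.
  have := npl; rewrite /p negb_and -!ltnNge (expnS 2) => /orP[] h; [right|left].
  + by apply: root_bound => //; apply: natr_scale_le K0 le_l _ C2; rewrite ?expn1.
  + by apply: root_bound => //; apply: natr_scale_le K0 le_l h C4.
- exists 100^-1, (32 * (2 ^ 5) ^ 4)%N; split=> [//|n T v d Omega P M eps delta alpha].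
  move=> n0 T0 eps01 /andP[_ delta3] _ mM dpM accM.
  (* Quadratic in vertices and quartic in time: a fourth and an eighth root. *)
  pose p l := (4 * (2 ^ l) ^ 2 <= n)%N && (32 * (2 ^ l) ^ 4 <= T)%N.
  have [||l [l5 /andP[pn pT] npl]] := @largest_scale p n.
  + rewrite /p T0 andbT; apply: leq_trans n0.
    by apply: leq_mul; [|rewrite leq_pexp2l].
  + by move=> l; rewrite /p => /andP[? _]; nia.
  have [|alpha0 le_l] := @scalar_error_bound R d Omega P n T M
      (fun G => core_number G v) _ _ _ _ l5 eps01 delta3 mM dpM accM.
    by apply: core_encoding; rewrite cardI // (ltn_exp2l 0) // (leq_trans _ l5).
  have C4 : 4%:R * (2 * 1080) ^+ 2 <= 100 ^+ (2 * 2) :> R.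
    by rewrite !exprS expr0; lra.
  have C8 : 32%:R * (2 * 1080) ^+ 4 <= 100 ^+ (2 * 4) :> R.
    by rewrite !exprS expr0; lra.
  rewrite (minr_pMr _ _ (ltW c0)) ge_min; apply/orP.
  have := npl; rewrite /p negb_and -!ltnNge (expnS 2) => /orP[] h; [right|left].
  + by apply: root_bound => //; apply: natr_scale_le K0 le_l h C4.
  + by apply: root_bound => //; apply: natr_scale_le K0 le_l h C8.
Qed.
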